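(* Let $p\ge 1$, let $S$ be a subdivided star with $\ell\ge 2$ leaves, let $\lambda$ be a $p$-periodic 1-labeling of $S$, and let $\mathcal{S}=(S,\lambda)$. Then $\max(1,\ell-p)\le M_p(\mathcal{S})\le \ell-1$. Both bounds are tight: for all $\ell\ge 2$ and $p\ge 1$ each of the two bounds is attained by some subdivided star with $\ell$ leaves and some $p$-periodic 1-labeling of it.
   Context: A subdivided star is a tree obtained from a star by subdividing its edges, each an arbitrary number (possibly zero) of times. A $p$-periodic 1-labeling $\lambda$ of a finite simple undirected graph $G=(V,E)$ assigns to each edge $e$ an infinite set of time-steps of the form $\{i,i+p,i+2p,\dots\}$ with $i\in\{1,\dots,p\}$ (so each edge is present exactly once in every $p$ consecutive time-steps). In the temporal graph $\mathcal{G}=(G,\lambda)$, a journey from $u$ to $v$ is a path in $G$ from $u$ to $v$ together with a choice, for each edge of the path, of a time-step in its label set so that the chosen time-steps are strictly increasing along the path. The temporal distance $\mathrm{dist}_t(u,v)$ is the smallest time-step at which a journey from $u$ reaches $v$ (with $\mathrm{dist}_t(u,u)=0$, and $\infty$ if there is no journey). A set $R\subseteq V$ is a temporal resolving set if (i) for every $v\in V$ there is a journey from some $s\in R$ to $v$ (every vertex is reached from itself), and (ii) for every two distinct $u,v\in V$ there is $s\in R$ with $\mathrm{dist}_t(s,u)\neq\mathrm{dist}_t(s,v)$. $M_p(\mathcal{G})$ denotes the minimum size of a temporal resolving set of $\mathcal{G}$. *)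

(* Defs.v *)
From HB Require Import structures.
From mathcomp Require Import all_boot.
From mathcomp Require Import boolp.

Set Implicit Arguments.
Unset Strict Implicit.
Unset Printing Implicit Defensive.

Record sgraph := SGraph {
  vertex :> finType;
  adj : rel vertex;
  adj_sym : symmetric adj;
  adj_irrefl : irreflexive adj }.

Definition edges (G : sgraph) : {set {set G}} :=
  [set [set xy.1; xy.2] | xy : G * G & adj xy.1 xy.2].

Definition leaves (G : sgraph) : {set G} :=
  [set x | #|[set y | adj x y]| == 1].

Definition isomorphic (G H : sgraph) : Prop :=
  exists2 f : G -> H, bijective f & forall x y, adj (f x) (f y) = adj x y.

Section SubdividedStar.
Variables (m : nat) (k : 'I_m -> nat).

(* The star K_{1,m} with its i-th edge subdivided k i times: None is the center
   and Some (i, j) is the vertex at distance j.+1 from the center on the path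
   replacing the i-th edge, whose last vertex is Some (i, k i). *)
Definition substar_vertex : finType := option {i : 'I_m & 'I_(k i).+1}.

Definition substar_adj : rel substar_vertex := fun x y =>
  match x, y with
  | None, None => false
  | None, Some u => tagged u == 0 :> nat
  | Some u, None => tagged u == 0 :> nat
  | Some u, Some v =>
      (tag u == tag v) &&
      (((tagged u).+1 == tagged v :> nat) || ((tagged v).+1 == tagged u :> nat))
  end.

Lemma substar_adj_sym : symmetric substar_adj.
Proof. by move=> [u|] [v|] //=; rewrite eq_sym orbC. Qed.

Lemma substar_adj_irrefl : irreflexive substar_adj.
Proof. by move=> [u|] //=; rewrite eqxx orbb /= eqn_leq ltnn. Qed.

Definition substar : sgraph := SGraph substar_adj_sym substar_adj_irrefl.
End SubdividedStar.

Definition subdivided_star (S : sgraph) : Prop :=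
  exists (m : nat) (k : 'I_m -> nat), isomorphic S (substar k).

(* A labeling assigns a set of time-steps to every unordered pair of vertices;
   its values outside [edges G] are never used. *)
Definition labeling (G : sgraph) : Type := {set G} -> nat -> Prop.

Definition periodic_1labeling (G : sgraph) (p : nat) (lam : labeling G) : Prop :=
  forall e, e \in edges G ->
    exists2 i, 1 <= i <= p & forall t, lam e t <-> exists n, t = i + n * p.

Section TemporalGraph.
Variables (G : sgraph) (lam : labeling G).

(* [q] lists the vertices after [u], and [ts] the time-steps chosen for the
   successive edges of the path [u :: q]. *)
Definition is_journey (u v : G) (q : seq G) (ts : seq nat) : Prop :=
  [/\ path (@adj G) u q, uniq (u :: q), last u q = v,
      size ts = size q /\ sorted ltn ts
    & forall i, i < size q ->
        lam (nth set0 (pairmap (fun x y => [set x; y]) u q) i) (nth 0 ts i)].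

(* The empty journey from a vertex to itself arrives at time 0. *)
Definition reaches_at (u v : G) (t : nat) : Prop :=
  exists (q : seq G) (ts : seq nat), is_journey u v q ts /\ last 0 ts = t.

Definition reaches (u v : G) : Prop :=
  exists (q : seq G) (ts : seq nat), is_journey u v q ts.

(* [None] stands for infinity. *)
Definition tdist (u v : G) : option nat :=
  if pselect (exists t, `[< reaches_at u v t >]) is left ex_t
  then Some (ex_minn ex_t) else None.

Definition temporal_resolving (R : {set G}) : Prop :=
  (forall v, exists2 s, s \in R & reaches s v) /\
  (forall u v, u != v -> exists2 s, s \in R & tdist s u != tdist s v).

(* The default value [set: G] is always admissible when the labels are positive,
   see [temporal_resolving_setT]. *)
Definition temporal_metric_dim : nat :=
  #|[arg min_(R < [set: G] | `[< temporal_resolving R >]) #|R| ]|.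

Lemma is_journey_nil (u : G) : is_journey u u [::] [::].
Proof. by split. Qed.

Lemma reaches_at_self (u : G) : reaches_at u u 0.
Proof. by exists [::], [::]; split=> //; apply: is_journey_nil. Qed.

Lemma tdist_self (u : G) : tdist u u = Some 0.
Proof.
rewrite /tdist; case: pselect => [ex_t|[]]; last first.
  by exists 0; apply/asboolP; apply: reaches_at_self.
case: ex_minnP => t _ /(_ 0) t_le; congr Some; apply/eqP.
by rewrite -leqn0 t_le //; apply/asboolP; apply: reaches_at_self.
Qed.

End TemporalGraph.

Lemma pairmap_edges (G : sgraph) (u : G) (q : seq G) (i : nat) :
  path (@adj G) u q -> i < size q ->
  nth set0 (pairmap (fun x y => [set x; y]) u q) i \in edges G.
Proof.
elim: q u i => [//|x q IHq] u [|i] /= /andP[ux xq]; last exact: IHq.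
by move=> _; apply/imsetP; exists (u, x); rewrite ?inE.
Qed.

Lemma temporal_resolving_setT (G : sgraph) (p : nat) (lam : labeling G) :
  periodic_1labeling p lam -> temporal_resolving lam [set: G].
Proof.
move=> lamP; split=> [v|u v neq_uv].
  by exists v; rewrite ?inE //; exists [::], [::]; apply: is_journey_nil.
exists u; rewrite ?inE // tdist_self /tdist.
case: pselect => [ex_t|//]; case: ex_minnP => t /asboolP[q [ts [uv <-]]] _.
case: uv => pq _ uv [sz_ts _] lam_ts; case/lastP: ts => [|ts t'] in sz_ts lam_ts *.
  by case: q sz_ts uv {pq lam_ts} => //= _ /eqP; rewrite (negPf neq_uv).
have lt_q : size ts < size q by rewrite -sz_ts size_rcons.
have := lam_ts _ lt_q; rewrite nth_rcons ltnn eqxx last_rcons => lam_t'.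
have [i /andP[i_gt0 _] /(_ t')[/(_ lam_t')[n ->] _]] :=
  lamP _ (pairmap_edges pq lt_q).
by apply/eqP => -[] /esym/eqP; rewrite addn_eq0 => /andP[/eqP i0]; rewrite i0 in i_gt0.
Qed.

(* Main.v *)
Require Import Defs.
From mathcomp Require Import all_boot.
From mathcomp Require Import boolp.
From mathcomp Require Import zify.

(** A journey from [s] to [v] passes through every vertex of the tree path from
    [s] to [v], so arrival times strictly increase along paths starting at [s].
    Hence the ends of all arms but one resolve: two vertices of distinct arms are
    separated by the end of one of these arms, since the center lies between
    them, and two vertices of the same arm lie on a common path from any arm end.
    Conversely, if two arms contain no element of [R] and their edges at the
    center carry the same label, then their first vertices are reached at the
    same time from all of [R]; as there are only [p] labels, at most [p] arms are
    free of [R]. In an unsubdivided star this is the only obstruction, which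
    makes the bounds tight for labels that are as distinct as possible,
    respectively all equal. *)

Set Implicit Arguments.
Unset Strict Implicit.
Unset Printing Implicit Defensive.

(** * Temporal distances, metric dimension and periodic labels *)

Lemma tdistP (G : sgraph) (lam : labeling G) (u v : G) :
  (exists t, reaches_at lam u v t) ->
  exists t, [/\ tdist lam u v = Some t, reaches_at lam u v t
              & forall t', reaches_at lam u v t' -> t <= t'].
Proof.
move=> [t0 uv_t0]; rewrite /tdist; case: pselect => [ex_t|[]]; last first.
  by exists t0; apply/asboolP.
case: ex_minnP => t /asboolP uv_t t_min; exists t; split=> // t' uv_t'.
by apply: t_min; apply/asboolP.
Qed.

(** Two graphs are allowed so that this serves transport along isomorphisms; with a single graph it
    shows that a source fails to separate two vertices. *)
Lemma eq_tdist (G G' : sgraph) (lam : labeling G) (lam' : labeling G')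
    (u v : G) (u' v' : G') :
  (forall t, reaches_at lam u v t <-> reaches_at lam' u' v' t) ->
  tdist lam u v = tdist lam' u' v'.
Proof.
move=> eq_uv; rewrite /tdist.
suff -> : reaches_at lam u v = reaches_at lam' u' v' by [].
by apply: funext => t; apply: propext.
Qed.

(** Periodicity makes the default [[set: G]] of the minimum admissible, so the minimum is attained
    by a genuine resolving set. *)
Lemma metric_dim_min (G : sgraph) (p : nat) (lam : labeling G) :
  periodic_1labeling p lam ->
  (exists2 R, temporal_resolving lam R & #|R| = temporal_metric_dim lam) /\
  (forall R, temporal_resolving lam R -> temporal_metric_dim lam <= #|R|).
Proof.
move=> /temporal_resolving_setT/asboolP resT; rewrite /temporal_metric_dim.
case: arg_minnP => // R /asboolP resR R_min; split; first by exists R.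
by move=> R' /asboolP; apply: R_min.
Qed.

Lemma periodic_gt0 (G : sgraph) (p : nat) (lam : labeling G) (x y : G) t :
  periodic_1labeling p lam -> adj x y -> lam [set x; y] t -> 0 < t.
Proof.
move=> lamP xy; have xyE : [set x; y] \in edges G.
  by apply/imsetP; exists (x, y); rewrite ?inE.
by have [i /andP[i0 _] lamE] := lamP _ xyE => /lamE[n ->]; rewrite addn_gt0 i0.
Qed.

Lemma periodic_later (G : sgraph) (p : nat) (lam : labeling G) (x y : G) t0 :
  0 < p -> periodic_1labeling p lam -> adj x y ->
  exists2 t, t0 < t & lam [set x; y] t.
Proof.
move=> p0 lamP xy; have xyE : [set x; y] \in edges G.
  by apply/imsetP; exists (x, y); rewrite ?inE.
have [i /andP[i0 _] lamE] := lamP _ xyE.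
(* Since [i] and [p] are positive, [i + t0 * p] is at least [1 + t0]. *)
exists (i + t0 * p); last by apply/lamE; exists t0.
by rewrite -add1n leq_add // leq_pmulr.
Qed.

(** * Invariance under isomorphism *)

Section Transport.
Variables (G H : sgraph) (f : G -> H) (lam : labeling H).
Hypotheses (f_bij : bijective f) (f_adj : forall x y, adj (f x) (f y) = adj x y).

(** The labeling that turns the graph isomorphism [f] into an isomorphism of temporal graphs. *)
Definition pull_labeling : labeling G := fun e => lam (f @: e).

Let f_inj : injective f. Proof. exact: bij_inj. Qed.

Lemma pull_is_journey u v q ts :
  is_journey pull_labeling u v q ts <-> is_journey lam (f u) (f v) (map f q) ts.
Proof.
rewrite /is_journey -map_cons (map_inj_uniq f_inj) last_map size_map.
have -> : path (@adj H) (f u) (map f q) = path (@adj G) u q.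
  by rewrite path_map; apply: eq_path => x y; apply: f_adj.
have lamE i : i < size q ->
    pull_labeling (nth set0 (pairmap (fun x y => [set x; y]) u q) i) (nth 0 ts i) =
    lam (nth set0 (pairmap (fun x y => [set x; y]) (f u) (map f q)) i) (nth 0 ts i).
  move=> lt_iq; rewrite /pull_labeling; congr (lam _ _).
  by elim: q u i lt_iq => [|x q IHq] u [|i] //= lt_iq; [rewrite imsetU1 imset_set1 | apply: IHq].
split=> -[? ? uv ? lam_ts]; split=> //; first by rewrite uv.
- by move=> i iq; rewrite -lamE //; apply: lam_ts.
- exact: f_inj.
- by move=> i iq; rewrite lamE //; apply: lam_ts.
Qed.

Lemma pull_tdist u v : tdist pull_labeling u v = tdist lam (f u) (f v).
Proof.
case: f_bij => g fK gK; apply: eq_tdist => t; split=> -[q [ts [uv <-]]].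
  by exists (map f q), ts; split=> //; apply/pull_is_journey.
exists (map g q), ts; split=> //; apply/pull_is_journey.
by rewrite -map_comp (eq_map gK) map_id.
Qed.

Lemma pull_reaches u v : reaches pull_labeling u v <-> reaches lam (f u) (f v).
Proof.
case: f_bij => g fK gK; split=> -[q [ts uv]].
  by exists (map f q), ts; apply/pull_is_journey.
exists (map g q), ts; apply/pull_is_journey.
by rewrite -map_comp (eq_map gK) map_id.
Qed.

Lemma pull_periodic p : periodic_1labeling p lam -> periodic_1labeling p pull_labeling.
Proof.
move=> lamP e /imsetP[[x y] /=]; rewrite inE /= => xy ->.
apply: lamP; rewrite imsetU1 imset_set1; apply/imsetP.
by exists (f x, f y); rewrite // inE /= f_adj.
Qed.

Lemma pull_resolving (R : {set G}) :
  temporal_resolving pull_labeling R <-> temporal_resolving lam (f @: R).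
Proof.
case: f_bij => g fK gK; split=> -[reach res]; split.
- move=> v; have [s sR sv] := reach (g v); exists (f s); first exact: imset_f.
  by rewrite -[v]gK; apply/pull_reaches.
- move=> u v uv; have [|s sR] := res (g u) (g v); first by rewrite (can_eq gK).
  by rewrite !pull_tdist !gK => ?; exists (f s) => //; apply: imset_f.
- move=> v; have [_ /imsetP[s sR ->] /pull_reaches] := reach (f v).
  by exists s.
- move=> u v uv; have [|_ /imsetP[s sR ->]] := res (f u) (f v).
    by rewrite (inj_eq f_inj).
  by rewrite -!pull_tdist; exists s.
Qed.

Lemma pull_metric_dim p : periodic_1labeling p lam ->
  temporal_metric_dim pull_labeling = temporal_metric_dim lam.
Proof.
move=> lamP; have [[R resR cardR] minR] := metric_dim_min lamP.
have [[R' resR' cardR'] minR'] := metric_dim_min (pull_periodic lamP).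
case: f_bij => g fK gK; apply/eqP; rewrite eqn_leq; apply/andP; split.
  (* An optimal set in [H] is carried back by [g], and below an optimal set in [G] is carried
     forward by [f]. *)
  rewrite -cardR -(card_imset _ (can_inj gK)) minR' //; apply/pull_resolving.
  by rewrite -imset_comp (eq_imset _ gK) imset_id.
by rewrite -cardR' -(card_imset _ f_inj) minR //; apply/pull_resolving.
Qed.

Lemma card_leaves_bij : #|leaves G| = #|leaves H|.
Proof.
rewrite -(card_imset _ f_inj); case: f_bij => g fK gK; apply: eq_card => y.
rewrite -[y]gK (mem_imset _ _ f_inj) !inE; congr (_ == _).
rewrite -(card_imset _ f_inj); apply: eq_card => z.
by rewrite -[z]gK (mem_imset _ _ f_inj) !inE f_adj.
Qed.

End Transport.

(** * Journeys from the root of a tree *)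

(* [par] orients every edge towards [s], and [d] is a potential witnessing that
   following [par] always ends at [s]. *)
Definition rooted_at (G : sgraph) (s : G) (par : G -> G) : Prop :=
  [/\ par s = s,
      forall x y, adj x y -> x = par y \/ y = par x
    & exists d : G -> nat, forall v, v != s -> adj (par v) v /\ d (par v) < d v].

Section Rooted.
Variables (G : sgraph) (p : nat) (lam : labeling G) (s : G) (par : G -> G).
Hypotheses (p_gt0 : 0 < p) (lamP : periodic_1labeling p lam).
Hypothesis sP : rooted_at s par.

(** By induction the vertex before the current one is its parent, so a step towards the root would
    revisit that vertex; at [s], which is its own parent, it would revisit [s]. *)
Lemma rooted_path q :
  path (@adj G) s q -> uniq (s :: q) -> path (fun x y => x == par y) s q.
Proof.
case: sP => par_s adj_par _; elim/last_ind: q => [//|q v IHq].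
rewrite -rcons_cons !rcons_path rcons_uniq => /andP[sq qv] /andP[vq uq].
rewrite IHq //=; apply/eqP; have [//|v_par] := adj_par _ _ qv.
have := IHq sq uq; case/lastP: q {IHq} => [|q x] in sq qv vq uq v_par *.
  by rewrite /= in v_par vq; rewrite v_par par_s inE eqxx in vq.
rewrite last_rcons in v_par; rewrite rcons_path -v_par => /andP[_ /eqP v_last].
by rewrite -rcons_cons mem_rcons inE -v_last mem_last orbT in vq.
Qed.

(** By [rooted_path] every journey to [v] ends with the edge from [par v]. This recursion determines
    all arrival times from the labels. *)
Lemma reaches_at_par v t : v != s ->
  reaches_at lam s v t <->
  exists2 t0, reaches_at lam s (par v) t0 & t0 < t /\ lam [set par v; v] t.
Proof.
move=> v_s; split=> [[q [ts [[sq uq]]]]|[t0 [q [ts [[sq uq last_q [sz_ts ts_sorted] lam_ts]]]]]].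
  case/lastP: q => [|q v'] in sq uq *; first by move=> /= /eqP; rewrite eq_sym (negPf v_s).
  rewrite last_rcons => def_v; rewrite {v'}def_v in sq uq *.
  have := rooted_path sq uq; rewrite !rcons_path => /andP[_ /eqP last_q].
  case/lastP: ts => [|ts t'] [sz_ts ts_sorted] lam_ts; first by rewrite size_rcons in sz_ts.
  rewrite !size_rcons in sz_ts lam_ts; case: sz_ts => sz_ts.
  rewrite last_rcons => def_t; rewrite {t'}def_t in ts_sorted lam_ts *.
  move: sq; rewrite rcons_path => /andP[sq qv].
  have szp := size_pairmap (fun x y : G => [set x; y]) s q.
  rewrite -cats1 pairmap_cat /= cats1 in lam_ts.
  have lam_t : lam [set par v; v] t.
    have := lam_ts (size q) (ltnSn _).
    by rewrite !nth_rcons szp sz_ts ltnn eqxx -last_q.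
  (* When [par v] is the root, the preceding arrival is the default 0 of [last], and [t0 < t] rests
     on the positivity of labels. *)
  have t_gt0 : 0 < t by apply: periodic_gt0 lamP _ lam_t; rewrite -last_q.
  exists (last 0 ts); last first.
    split=> //; case: ts ts_sorted {sz_ts lam_ts} => //= t1 ts.
    by rewrite rcons_path => /andP[].
  exists q, ts; split=> //; split=> //.
  - by move: uq; rewrite -rcons_cons rcons_uniq => /andP[].
  - split=> //; case: ts ts_sorted {sz_ts lam_ts} => //= t1 ts.
    by rewrite rcons_path => /andP[].
  - move=> i iq; have := lam_ts _ (ltnW iq : i < (size q).+1).
    by rewrite !nth_rcons szp sz_ts iq.
move=> last_ts; rewrite -last_ts => -[lt_t lam_t].
have [_ _ [d /(_ _ v_s)[pv_v _]]] := sP.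
(* If the path to [par v] already met [v], it would have passed [par v] just before [v] and would
   end there again. *)
have v_q : v \notin s :: q.
  rewrite inE (negPf v_s) /=; apply/negP => v_q.
  have := rooted_path sq uq; move: v_q uq last_q {sq sz_ts lam_ts}.
  case/splitPr => q1 q2; rewrite -cat_cons cat_uniq last_cat => /and3P[_ dis /= /andP[v_q2 _]].
  rewrite cat_path /= => last_q /and3P[_ /eqP last_q1 _].
  move/hasPn: dis => /(_ (par v)); rewrite -{2}last_q1 mem_last /=.
  by rewrite -last_q mem_last => /(_ isT).
exists (rcons q v), (rcons ts t); split; last by rewrite last_rcons.
split; rewrite ?last_rcons //.
- by rewrite rcons_path sq last_q.
- by rewrite -rcons_cons rcons_uniq v_q.
- rewrite !size_rcons sz_ts; split=> //.
  by case: ts ts_sorted lt_t {sz_ts lam_ts last_ts} => //= t1 ts; rewrite rcons_path => ->.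
- have szp := size_pairmap (fun x y : G => [set x; y]) s q.
  move=> i; rewrite size_rcons -cats1 pairmap_cat /= cats1 !nth_rcons szp sz_ts ltnS.
  rewrite leq_eqVlt => /orP[/eqP ->|iq]; first by rewrite ltnn eqxx last_q.
  by rewrite iq; apply: lam_ts.
Qed.

(** Induction on the potential: a journey to the parent extends to [v] after waiting for a later
    occurrence of the last edge. *)
Lemma rooted_reaches_at v : exists t, reaches_at lam s v t.
Proof.
have [_ _ [d dP]] := sP; have [n] := ubnP (d v); elim: n v => // n IHn v dv.
have [->|v_s] := eqVneq v s; first by exists 0; apply: reaches_at_self.
have [pv_v d_lt] := dP _ v_s.
have [|t0 t0P] := IHn (par v); first by apply: leq_trans d_lt _; rewrite -ltnS.
have [t t0_t lam_t] := periodic_later t0 p_gt0 lamP pv_v.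
by exists t; apply/reaches_at_par => //; exists t0.
Qed.

Lemma rooted_reaches v : reaches lam s v.
Proof. by have [t [q [ts [sv _]]]] := rooted_reaches_at v; exists q, ts. Qed.

Definition arrival v := odflt 0 (tdist lam s v).

Lemma tdist_arrival v : tdist lam s v = Some (arrival v).
Proof. by rewrite /arrival; have [t [-> _ _]] := tdistP (rooted_reaches_at v). Qed.

(** A fastest journey to [v] passes [par v] strictly earlier, hence no sooner than the earliest
    arrival there. *)
Lemma arrival_par v : v != s ->
  arrival (par v) < arrival v /\ lam [set par v; v] (arrival v).
Proof.
move=> v_s; have [t [tE]] := tdistP (rooted_reaches_at v).
case/(reaches_at_par _ v_s) => t0 t0P [t0_t lam_t] _.
have [t' [t'E _ /(_ _ t0P) t'_t0]] := tdistP (rooted_reaches_at (par v)).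
by rewrite /arrival tE t'E /=; split=> //; apply: leq_ltn_trans t'_t0 _.
Qed.

End Rooted.

(** * Coordinates, parents and distances in a subdivided star *)

Section Substar.
Variables (m : nat) (k : 'I_m -> nat).
Local Notation H := (substar k).
Local Notation vtx := {i : 'I_m & 'I_(k i).+1}.
Implicit Types (i j : 'I_m) (u v : vtx).

(** Positions are plain numbers to avoid arithmetic in a dependent ordinal type; [inord] sends those
    beyond [k i] to 0, whence the bounds [b <= k i] below. *)
Definition arm_vertex i (b : nat) : vtx := Tagged (fun i => 'I_(k i).+1) (inord b : 'I_(k i).+1).

Definition arm i b : H := Some (arm_vertex i b).

Lemma arm_vertexK u : arm_vertex (tag u) (tagged u) = u.
Proof. by case: u => i b; rewrite /arm_vertex /= inord_val. Qed.

Lemma arm_val i b : b <= k i -> tagged (arm_vertex i b) = b :> nat.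
Proof. by move=> bk; rewrite /= inordK. Qed.

Lemma armP (x : H) : x = None \/ exists i b, b <= k i /\ x = arm i b.
Proof.
case: x => [u|]; [right|by left]; exists (tag u), (tagged u).
by rewrite /arm arm_vertexK -ltnS ltn_ord.
Qed.

Lemma arm_eq i j b c : b <= k i -> c <= k j ->
  (arm i b == arm j c) = (i == j) && (b == c).
Proof.
move=> bi cj; apply/eqP/andP => [/Some_inj eq_v|[/eqP -> /eqP -> //]].
have /= := congr1 (@tag _ _) eq_v; move=> eq_ij; rewrite eq_ij eqxx; split=> //.
have : (tagged (arm_vertex i b) : nat) = tagged (arm_vertex j c) by rewrite eq_v.
by rewrite !arm_val // => ->.
Qed.

Lemma adj_arm i j b c : b <= k i -> c <= k j ->
  adj (arm i b) (arm j c) = (i == j) && ((b.+1 == c) || (c.+1 == b)).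
Proof. by move=> bi cj; rewrite /= !inordK. Qed.

Lemma adj_center i b : b <= k i -> adj (None : H) (arm i b) = (b == 0).
Proof. by move=> bi; rewrite /= inordK. Qed.

(* The neighbour of [x] on the path to [s], with [parent s s = s]. *)
Definition parent (s x : H) : H :=
  match x, s with
  | None, None => None
  | None, Some u => arm (tag u) 0
  | Some v, None => if tagged v == 0 :> nat then None else arm (tag v) (tagged v).-1
  | Some v, Some u =>
      if (tag v == tag u) && (tagged v <= tagged u) then
        if tagged v == tagged u :> nat then Some v else arm (tag v) (tagged v).+1
      else if tagged v == 0 :> nat then None else arm (tag v) (tagged v).-1
  end.

Lemma parent_center i a : a <= k i -> parent (arm i a) None = arm i 0.
Proof. by []. Qed.

Lemma parent_arm i j a b : a <= k i -> b <= k j ->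
  parent (arm i a) (arm j b) =
    if (j == i) && (b <= a) then if b == a then arm j b else arm j b.+1
    else if b == 0 then None else arm j b.-1.
Proof. by move=> ai bj; rewrite /parent /arm /= !inordK. Qed.

Lemma parent_from_center j b : b <= k j ->
  parent None (arm j b) = if b == 0 then None else arm j b.-1.
Proof. by move=> bj; rewrite /parent /arm /= !inordK. Qed.

(** The graph distance, serving as the potential in [rooted_parent]. Two truncated differences add
    up to an absolute difference, and on distinct arms the distances to the center are added. *)
Definition distance (s x : H) : nat :=
  match s, x with
  | None, None => 0
  | None, Some u | Some u, None => (tagged u).+1
  | Some u, Some v =>
      if tag u == tag v then (tagged u - tagged v) + (tagged v - tagged u)
      else tagged u + (tagged v).+2
  end.

Lemma distance_center i a : a <= k i -> distance (arm i a) None = a.+1.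
Proof. by move=> ai; rewrite /distance /arm /= inordK. Qed.

Lemma distance_arm i j a b : a <= k i -> b <= k j ->
  distance (arm i a) (arm j b) = if i == j then (a - b) + (b - a) else a + b.+2.
Proof. by move=> ai bj; rewrite /distance /arm /= !inordK. Qed.

Lemma distance_from_center j b : b <= k j -> distance None (arm j b) = b.+1.
Proof. by move=> bj; rewrite /distance /arm /= !inordK. Qed.

Lemma rooted_parent (s : H) : rooted_at s (parent s).
Proof.
case: (armP s) => [->|[i [a [ai ->]]]]; split=> //.
- move=> x y.
  case: (armP x) => [->|[j [b [bj ->]]]]; case: (armP y) => [->|[j' [c [cj ->]]]] //.
  + by rewrite adj_center // => /eqP ->; left; rewrite parent_from_center.
  + by rewrite adj_sym adj_center // => /eqP ->; right; rewrite parent_from_center.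
  + rewrite adj_arm // => /andP[/eqP def_j /orP[]/eqP def_b]; [left|right];
      by rewrite parent_from_center // -def_b /= def_j.
- exists (distance None) => x.
  case: (armP x) => [->|[j [b [bj ->]]]] // _; rewrite parent_from_center //.
  case: b bj => [|b] bj; first by rewrite adj_center.
  by rewrite adj_arm ?distance_from_center ?(ltnW bj) // !eqxx.
- by rewrite parent_arm // eqxx leqnn eqxx.
- move=> x y.
  case: (armP x) => [->|[j [b [bj ->]]]]; case: (armP y) => [->|[j' [c [cj ->]]]] //.
  + rewrite adj_center // => /eqP ->; rewrite parent_arm //.
    by case: eqP => [->|_] /=; [right|left].
  + rewrite adj_sym adj_center // => /eqP ->; rewrite parent_arm //.
    by case: eqP => [->|_] /=; [left|right].
  + rewrite adj_arm // => /andP[/eqP def_j bc]; rewrite def_j in bj *.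
    rewrite !parent_arm //; case: (j' =P i) => [_|_] /=; last first.
      by case/orP: bc => /eqP <-; [left|right].
    case/orP: bc => /eqP <- /=; [have := ltngtP b a | have := ltngtP c a].
      by case=> ?; [right|left|left].
    by case=> ?; [left|right|right].
- exists (distance (arm i a)) => x.
  case: (armP x) => [->|[j [b [bj ->]]]] neq_x.
    rewrite parent_center // adj_sym adj_center //; split=> //.
    by rewrite distance_center // distance_arm // eqxx; lia.
  rewrite arm_eq // in neq_x; rewrite parent_arm //.
  case: (j =P i) neq_x => [def_j|/eqP neq_j _].
    (* On the arm of the root, the parent lies outward for positions below [a] and inward for
       positions above it. *)
    rewrite !andTb => /negPf neq_b; case: (leqP b a) => ba.
      have lt_ba : b < a by rewrite ltn_neqAle neq_b.
      have b1j : b.+1 <= k j by rewrite def_j; apply: leq_trans ai.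
      by rewrite neq_b adj_arm ?eqxx ?orbT // !distance_arm // def_j eqxx; split=> //; lia.
    case: b bj neq_b ba => // b bj _ ba.
    rewrite adj_arm ?(ltnW bj) // !eqxx !distance_arm ?(ltnW bj) // def_j eqxx.
    by split=> //; lia.
  case: b bj => [|b] bj.
    rewrite adj_center // distance_center // distance_arm // [i == j]eq_sym (negPf neq_j).
    by split=> //; lia.
  rewrite adj_arm ?(ltnW bj) // !eqxx !distance_arm ?(ltnW bj) // [i == j]eq_sym (negPf neq_j).
  by split=> //; lia.
Qed.


(** * Leaves of a subdivided star *)

Definition arm_end i : H := arm i (k i).

Lemma card_arm_ends (I : {set 'I_m}) : #|[set arm_end i | i in I]| = #|I|.
Proof.
by apply: card_imset => i j /eqP; rewrite arm_eq // => /andP[/eqP].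
Qed.

(** Nothing lies beyond position [k i], so only the inward neighbour remains, which is the center
    when [k i = 0]. *)
Lemma adj_arm_end i y : adj (arm_end i) y = (y == parent None (arm_end i)).
Proof.
rewrite /arm_end parent_from_center //; case: (armP y) => [->|[j [b [bj ->]]]].
  by rewrite adj_sym adj_center //; case: eqP.
rewrite adj_arm //; case: (k i =P 0) => ki.
  apply: (@etrans _ _ false) => //; rewrite ki.
  by case: eqP => //= eq_ij; rewrite -eq_ij ki in bj; lia.
rewrite arm_eq //; last by apply: leq_trans (leq_pred _) _.
by rewrite eq_sym; case: eqP => //= eq_ij; rewrite eq_ij in bj *; lia.
Qed.

Lemma arm_ends_sub_leaves : [set arm_end i | i in [set: 'I_m]] \subset leaves H.
Proof.
apply/subsetP => _ /imsetP[i _ ->]; rewrite inE; apply/cards1P.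
by exists (parent None (arm_end i)); apply/setP => y; rewrite !inE adj_arm_end.
Qed.

Lemma leaves_sub_arm_ends : leaves H \subset None |: [set arm_end i | i in [set: 'I_m]].
Proof.
apply/subsetP => x; rewrite !inE => /eqP deg_x.
case: (armP x) deg_x => [->|[i [b [bi ->]]]] deg_x; first by rewrite eqxx.
move: bi; rewrite leq_eqVlt => /orP[/eqP ->|bi]; first by rewrite imset_f ?orbT.
have /card_le1_eqP/(_ (arm i b.+1) (parent None (arm i b))) := eq_leq deg_x.
rewrite !inE adj_arm ?(ltnW bi) // !eqxx parent_from_center ?(ltnW bi) //.
case: b bi {deg_x} => [|b] bi.
  by rewrite adj_sym adj_center // => /(_ isT isT).
rewrite adj_arm ?eqxx ?orbT ?(ltnW bi) ?(ltnW (ltnW bi)) // => /(_ isT isT)/eqP.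
by rewrite arm_eq // ?(ltnW (ltnW bi)) // => /andP[_ /eqP]; lia.
Qed.

Lemma center_notin_leaves : 1 < m -> None \notin leaves H.
Proof.
move=> m_gt1; rewrite inE; apply/negP => /eqP deg_c.
pose i0 := Ordinal (ltnW m_gt1); pose i1 := Ordinal m_gt1.
have /card_le1_eqP/(_ (arm i0 0) (arm i1 0)) := eq_leq deg_c.
by rewrite !inE !adj_center // => /(_ isT isT)/eqP; rewrite arm_eq.
Qed.

Lemma card_leaves_substar_le : m <= #|leaves H| <= m.+1.
Proof.
have card_ends : #|[set arm_end i | i in [set: 'I_m]]| = m.
  by rewrite card_arm_ends cardsT card_ord.
rewrite -{1}card_ends subset_leq_card ?arm_ends_sub_leaves //=.
apply: leq_trans (subset_leq_card leaves_sub_arm_ends) _.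
by rewrite cardsU1 card_ends; case: (_ \notin _).
Qed.

Lemma card_leaves_substar : 1 < m -> #|leaves H| = m.
Proof.
move=> m_gt1; apply/eqP; rewrite eqn_leq andbC.
have /andP[-> _] := card_leaves_substar_le.
rewrite -[X in _ <= X]card_ord -cardsT -card_arm_ends; apply: subset_leq_card.
apply/subsetP => x x_leaf; have /subsetP/(_ _ x_leaf) := leaves_sub_arm_ends.
rewrite !inE => /orP[/eqP x_c|/imsetP[i _ ->]]; last exact: imset_f.
by rewrite x_c (negPf (center_notin_leaves m_gt1)) in x_leaf.
Qed.

(** * Upper and lower bounds for a labeled subdivided star *)

Section Labeled.
Variables (p : nat) (lam : labeling H).
Hypotheses (p_gt0 : 0 < p) (lamP : periodic_1labeling p lam).
Local Notation arrival := (arrival lam).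

Lemma arrival_lt_tdist_neq (s x y : H) :
  arrival s x < arrival s y -> tdist lam s x != tdist lam s y.
Proof.
move=> lt_xy; rewrite !(tdist_arrival p_gt0 lamP (rooted_parent s)).
by apply/eqP => -[eq_xy]; rewrite eq_xy ltnn in lt_xy.
Qed.

Lemma arrival_parent (s x : H) : x != s -> arrival s (parent s x) < arrival s x.
Proof. by case/(arrival_par p_gt0 lamP (rooted_parent s)). Qed.

(** This lemma and the next three chain [arrival_parent] along paths leaving the source: outward on
    other arms, and inward to the center on the arm whose end is the source. *)
Lemma arrival_away i j a b c : a <= k i -> j != i -> b < c <= k j ->
  arrival (arm i a) (arm j b) < arrival (arm i a) (arm j c).
Proof.
move=> ai ji /andP[bc]; elim: c bc => // c IHc bc cj.
have := @arrival_parent (arm i a) (arm j c.+1).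
rewrite arm_eq // (negPf ji) parent_arm // (negPf ji) => /(_ isT) lt_c.
move: bc; rewrite ltnS leq_eqVlt => /orP[/eqP -> //|bc].
by apply: ltn_trans lt_c; apply: IHc; rewrite // ltnW.
Qed.

Lemma arrival_center_away i j a b : a <= k i -> j != i -> b <= k j ->
  arrival (arm i a) None < arrival (arm i a) (arm j b).
Proof.
move=> ai ji bj; have := @arrival_parent (arm i a) (arm j 0).
rewrite arm_eq // (negPf ji) parent_arm // (negPf ji) => /(_ isT) lt_0.
case: b bj => // b bj; apply: ltn_trans lt_0 _; exact: arrival_away.
Qed.

Lemma arrival_inward i b c : b < c <= k i ->
  arrival (arm_end i) (arm i c) < arrival (arm_end i) (arm i b).
Proof.
move=> /andP[bc ci]; elim: c bc ci => // c IHc bc ci.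
have := @arrival_parent (arm_end i) (arm i c); rewrite /arm_end.
rewrite arm_eq ?(ltnW ci) // eqxx andTb neq_ltn ci => /(_ isT).
rewrite parent_arm ?(ltnW ci) // eqxx (ltn_eqF ci) => lt_c.
move: bc; rewrite ltnS leq_eqVlt => /orP[/eqP -> //|bc].
by apply: ltn_trans lt_c _; apply: IHc; rewrite // ltnW.
Qed.

Lemma arrival_inward_center i b : b <= k i ->
  arrival (arm_end i) (arm i b) < arrival (arm_end i) None.
Proof.
move=> bi; have lt_0 := @arrival_parent (arm_end i) None isT.
rewrite parent_center // in lt_0; case: b bi => // b bi.
by apply: ltn_trans lt_0; apply: arrival_inward; rewrite bi.
Qed.

(** The covering hypothesis leaves out at most one arm. Only a pair on distinct arms calls for a
    particular source; any other pair lies on a common path from any chosen end [i0]. *)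
Lemma arm_ends_resolving (I : {set 'I_m}) : I != set0 ->
  (forall i j, i != j -> i \in I \/ j \in I) ->
  temporal_resolving lam [set arm_end i | i in I].
Proof.
move=> /set0Pn[i0 i0I] coverI; split=> [x|x y neq_xy].
  exists (arm_end i0); first exact: imset_f.
  exact: rooted_reaches p_gt0 lamP (rooted_parent _) _.
suff [i iI] : exists2 i, i \in I &
    arrival (arm_end i) x < arrival (arm_end i) y \/
    arrival (arm_end i) y < arrival (arm_end i) x.
  move=> lt_xy; exists (arm_end i); first exact: imset_f.
  by case: lt_xy => /arrival_lt_tdist_neq //; rewrite eq_sym.
case: (armP x) (armP y) neq_xy => [->|[i [b [bi ->]]]] [->|[j [c [cj ->]]]] //.
- move=> _; exists i0 => //; case: (eqVneq i0 j) cj => [<-|ji] cj; [right|left].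
    by apply: arrival_inward_center.
  by apply: arrival_center_away => //; rewrite eq_sym.
- move=> _; exists i0 => //; case: (eqVneq i0 i) bi => [<-|ji] bi; [left|right].
    by apply: arrival_inward_center.
  by apply: arrival_center_away => //; rewrite eq_sym.
rewrite arm_eq //; have [eq_ij /= bc|neq_ij _] := eqVneq i j.
  rewrite -{j}eq_ij in cj *; exists i0 => //; case: (eqVneq i0 i) => [->|ji].
    by move: bc; rewrite neq_ltn => /orP[bc|bc]; [right|left];
      apply: arrival_inward; apply/andP.
  by move: bc; rewrite neq_ltn => /orP[bc|bc]; [left|right];
    apply: arrival_away; rewrite // ?bc // eq_sym.
have [iI|jI] := coverI _ _ neq_ij; [exists i => //; left|exists j => //; right].
  apply: ltn_trans (arrival_inward_center _) (arrival_center_away _ _ _) => //.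
  by rewrite eq_sym.
exact: ltn_trans (arrival_inward_center _) (arrival_center_away _ _ _).
Qed.

(** The colouring [c] groups arms with equal central labels. Taking [r = p] gives the lower bound,
    and [r = 1] the tightness of the upper bound. *)
Lemma resolving_card_ge r (c : 'I_m -> 'I_r) (R : {set H}) :
  (forall i j, c i = c j ->
     lam [set None; arm i 0] = lam [set None; arm j 0]) ->
  temporal_resolving lam R -> m <= #|R| + r.
Proof.
move=> same_label [_ resR].
(* The arms that meet [R]; [omap tag] sends the center to [None], so each element of [R] hits at
   most one arm. *)
pose hit := [set i | Some i \in [set omap tag s | s : H in R]].
have card_hit : #|hit| <= #|R|.
  apply: leq_trans (leq_imset_card (omap tag) R).
  rewrite -(card_imset _ Some_inj); apply: subset_leq_card.
  by apply/subsetP => _ /imsetP[i + ->]; rewrite inE.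
have parent_free i s : i \notin hit -> s \in R -> parent s (arm i 0) = None.
  rewrite inE => /negP hit_i sR; case: (armP s) sR => [->|[j [a [aj ->]]]] sR.
    by rewrite parent_from_center.
  rewrite parent_arm //; case: eqP => // eq_ij; case: hit_i.
  by apply/imsetP; exists (arm j a); rewrite //= eq_ij.
have neq_free i s : i \notin hit -> s \in R -> arm i 0 != s.
  move=> /parent_free par_i /par_i; apply: contra_eq_neq => <-.
  by have [-> _ _] := rooted_parent (arm i 0).
(* The colouring is injective on free arms: first vertices of two free arms of one colour are
   entered from the center through equally labeled edges, so no source in [R] separates them. *)
have card_free : #|~: hit| <= r.
  rewrite -[r]card_ord -(@card_in_imset _ _ c) ?max_card // => i j.
  rewrite inE => hit_i; rewrite inE => hit_j /same_label eq_lam.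
  apply/eqP; apply: contraT => neq_ij.
  have [|s sR /eqP[]] := resR (arm i 0) (arm j 0); first by rewrite arm_eq // andbT.
  apply: eq_tdist => t.
  have := reaches_at_par lamP (rooted_parent s) t (neq_free _ _ hit_i sR).
  have := reaches_at_par lamP (rooted_parent s) t (neq_free _ _ hit_j sR).
  by rewrite !parent_free // eq_lam => <-.
by rewrite -[X in X <= _]card_ord -(cardsC hit) leq_add.
Qed.

(** The offset of a label in [1..p] determines the label; it is shifted down by one to become an
    ordinal below [p]. *)
Lemma exists_first_residue : exists c : 'I_m -> 'I_p, forall i j, c i = c j ->
  lam [set None; arm i 0] = lam [set None; arm j 0].
Proof.
have /choice[c cP] : forall i, exists r : 'I_p, forall t,
    lam [set None; arm i 0] t <-> exists n, t = r.+1 + n * p.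
  move=> i; have [|[|r] // r_p lamE] := lamP (_ : [set None; arm i 0] \in edges H).
    by apply/imsetP; exists (None, arm i 0); rewrite // inE adj_center.
  by exists (Ordinal r_p).
by exists c => i j eq_c; apply: funext => t; apply: propext; rewrite !cP eq_c.
Qed.

Lemma substar_metric_dim_bounds : 1 < #|leaves H| ->
  maxn 1 (#|leaves H| - p) <= temporal_metric_dim lam <= #|leaves H| - 1.
Proof.
have /andP[m_le le_m] := card_leaves_substar_le => l_gt1.
have [[R resR <-] minR] := metric_dim_min lamP; apply/andP; split.
  have R_gt0 : 0 < #|R|.
    by have [s sR _] := (resR.1 None); apply/card_gt0P; exists s.
  have [c /resolving_card_ge/(_ resR) m_R] := exists_first_residue.
  rewrite geq_max R_gt0 leq_subLR addnC; have [m_gt1|m_le1] := ltnP 1 m.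
    by rewrite card_leaves_substar.
  (* Here [m <= 1], so there are at most two leaves and the nonempty [R] suffices. *)
  by lia.
have [m_gt1|m_le1] := ltnP 1 m.
  pose i0 := Ordinal m_gt1; have card_I : #|[set~ i0]| = m.-1 by rewrite cardsC1 card_ord.
  rewrite card_leaves_substar // subn1 -card_I -card_arm_ends minR //.
  apply: arm_ends_resolving; first by rewrite -card_gt0 card_I -subn1 subn_gt0.
  move=> i j neq_ij; rewrite !inE; have [eq_i|] := eqVneq i i0; [right|by left].
  by rewrite -eq_i eq_sym.
(* With a single arm the graph is a path with two leaves, the center being one of them, and the end
   of the arm alone resolves it. *)
have m1 : m = 1 by lia.
apply: leq_trans (_ : #|[set arm_end i | i in [set: 'I_m]]| <= _).
  apply: minR; apply: arm_ends_resolving; last by move=> i j _; left; rewrite inE.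
  by rewrite -card_gt0 cardsT card_ord m1.
by rewrite card_arm_ends cardsT card_ord; lia.
Qed.

End Labeled.
End Substar.

(** * Unsubdivided stars with prescribed labels *)

Section Star.
Variables (l p : nat) (c : 'I_l -> nat).
Hypotheses (l_gt1 : 1 < l) (p_gt0 : 0 < p) (c_lt : forall i, c i < p).

Definition star : sgraph := substar (fun _ : 'I_l => 0).

Definition ray (i : 'I_l) : star := @arm l (fun=> 0) i 0.

(* Every edge of the star contains exactly one vertex of the form [ray i]. *)
Definition star_labeling : labeling star := fun e t =>
  exists2 i, ray i \in e & exists n, t = (c i).+1 + n * p.

Lemma ray_eq i j : (ray i == ray j) = (i == j).
Proof. by rewrite arm_eq // andbT. Qed.

Lemma star_vertexP (x : star) : x = None \/ exists i, x = ray i.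
Proof.
case: (armP x) => [|[i [b [b0 ->]]]]; [by left | right].
by exists i; move: b0; rewrite leqn0 => /eqP ->.
Qed.

Lemma star_labelingE i t :
  star_labeling [set None; ray i] t <-> exists n, t = (c i).+1 + n * p.
Proof.
split=> [[j]|]; last by exists i; rewrite // !inE eqxx orbT.
by rewrite !inE ray_eq /= => /eqP ->.
Qed.

Lemma star_periodic : periodic_1labeling p star_labeling.
Proof.
have rayP i : exists2 r, 1 <= r <= p & forall t,
    star_labeling [set None; ray i] t <-> exists n, t = r + n * p.
  by exists (c i).+1; [exact: c_lt | exact: star_labelingE].
move=> e /imsetP[[x y] /=]; rewrite inE /= => xy ->{e}.
case: (star_vertexP x) (star_vertexP y) xy => [->|[i ->]] [->|[j ->]] //.
  by rewrite setUC.
by rewrite /= !inordK ?andbF.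
Qed.

Lemma card_leaves_star : #|leaves star| = l.
Proof. exact: card_leaves_substar. Qed.

Lemma star_subdivided : subdivided_star star.
Proof. by exists l, (fun=> 0), id => //; exists id. Qed.

Lemma star_metric_dim_bounds :
  maxn 1 (l - p) <= temporal_metric_dim star_labeling <= l - 1.
Proof.
have := substar_metric_dim_bounds p_gt0 star_periodic.
by rewrite card_leaves_star => /(_ l_gt1).
Qed.

(** A ray of [I] is separated from every other vertex by itself as source. Rays outside [I] are
    reached from [ray i0] at times whose residues modulo [p] are given by [c], which is injective
    there. *)
Lemma rays_resolving (I : {set 'I_l}) : I != set0 ->
  (forall i j, i \notin I -> j \notin I -> c i = c j -> i = j) ->
  temporal_resolving star_labeling [set ray i | i in I].
Proof.
move=> /set0Pn[i0 i0I] c_inj; split=> [x|].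
  exists (ray i0); first exact: imset_f.
  exact: rooted_reaches p_gt0 star_periodic (rooted_parent _) _.
have lt_neq s x y := @arrival_lt_tdist_neq _ _ _ _ p_gt0 star_periodic s x y.
have res_ray i y : i \in I -> ray i != y ->
    tdist star_labeling (ray i) (ray i) != tdist star_labeling (ray i) y.
  move=> iI neq_y; apply: lt_neq; case: (star_vertexP y) neq_y => [->|[j ->]].
    by move=> _; apply: (arrival_inward_center p_gt0 star_periodic).
  rewrite ray_eq => neq_j.
  apply: ltn_trans (arrival_inward_center p_gt0 star_periodic _) _ => //.
  by apply: (arrival_center_away p_gt0 star_periodic); rewrite // eq_sym.
have res_center j : exists2 s, s \in [set ray i | i in I] &
    tdist star_labeling s None != tdist star_labeling s (ray j).
  exists (ray i0); first exact: imset_f.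
  have [<-|neq_j] := eqVneq i0 j; first by rewrite eq_sym res_ray.
  by apply: lt_neq; apply: (arrival_center_away p_gt0 star_periodic); rewrite // eq_sym.
move=> x y; case: (star_vertexP x) (star_vertexP y) => [->|[i ->]] [->|[j ->]] //.
  by move=> _; have [s sR] := res_center i; exists s; rewrite // eq_sym.
rewrite ray_eq => neq_ij; have [iI|iI] := boolP (i \in I).
  by exists (ray i); [exact: imset_f | apply: res_ray; rewrite ?ray_eq].
have [jI|jI] := boolP (j \in I).
  by exists (ray j); [exact: imset_f | rewrite eq_sym res_ray ?ray_eq // eq_sym].
exists (ray i0); first exact: imset_f.
have label_arrival h : h \notin I -> exists n,
    arrival star_labeling (ray i0) (ray h) = (c h).+1 + n * p.
  move=> hI; have neq_h : h != i0 by apply: contraNneq hI => ->.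
  apply/star_labelingE.
  have [|_] := arrival_par p_gt0 star_periodic (rooted_parent (ray i0)) (v := ray h).
    by rewrite ray_eq.
  by rewrite parent_arm // (negPf neq_h).
rewrite !(tdist_arrival p_gt0 star_periodic (rooted_parent _)); apply/eqP => -[].
have [[n ->] [n' ->]] := (label_arrival i iI, label_arrival j jI) => eq_t.
case/eqP: neq_ij; apply: c_inj => //.
(* Equal arrival times agree modulo [p], and both values of [c] are below [p]. *)
have /(congr1 (modn^~ p)) : n * p + c i = n' * p + c j by lia.
by rewrite !modnMDl !modn_small.
Qed.

End Star.

(** The first [p] rays carry distinct labels and may all be left out of the resolving set, as long
    as one ray stays in it. *)
Lemma star_metric_dim_distinct l p (l_gt1 : 1 < l) (p_gt0 : 0 < p) :
  temporal_metric_dim (star_labeling p (fun i : 'I_l => i %% p)) = maxn 1 (l - p).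
Proof.
have c_lt (i : 'I_l) : i %% p < p by rewrite ltn_mod.
have starP := star_periodic c_lt.
have /andP[dim_ge _] := star_metric_dim_bounds l_gt1 p_gt0 c_lt.
apply/eqP; rewrite eqn_leq dim_ge andbT; have [_ minR] := metric_dim_min starP.
(* The number of rays left out: at most [p] for distinct labels and at most [l.-1] to keep [I]
   nonempty. Then [l - q] equals [maxn 1 (l - p)]. *)
pose q := minn p l.-1; have q_l : q < l by rewrite /q; lia.
pose I := [set i : 'I_l | q <= i].
have q_le : q <= #|~: I|.
  have widen_inj : injective (widen_ord (ltnW q_l)) by move=> i j [] /val_inj.
  rewrite -{1}[q]card_ord -(card_imset _ widen_inj); apply: subset_leq_card.
  by apply/subsetP => _ /imsetP[i _ ->]; rewrite !inE -ltnNge; apply: (ltn_ord i).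
have card_I : #|I| <= maxn 1 (l - p).
  by have := cardsC I; rewrite card_ord /q in q_le *; lia.
have I_neq0 : I != set0 by apply/set0Pn; exists (Ordinal q_l); rewrite inE.
apply: leq_trans (minR _ (rays_resolving l_gt1 p_gt0 c_lt I_neq0 _)) _.
  move=> i j; rewrite !inE -!ltnNge /q !leq_min => /andP[ip _] /andP[jp _].
  by rewrite !modn_small // => /val_inj.
by rewrite card_imset // => i j /eqP; rewrite ray_eq => /eqP.
Qed.

Lemma star_metric_dim_constant l p (l_gt1 : 1 < l) (p_gt0 : 0 < p) :
  temporal_metric_dim (star_labeling p (fun _ : 'I_l => 0)) = l - 1.
Proof.
have c_lt (i : 'I_l) : 0 < p by [].
have starP := star_periodic c_lt.
have /andP[_ dim_le] := star_metric_dim_bounds l_gt1 p_gt0 c_lt.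
have [[R resR cardR] _] := metric_dim_min starP.
apply/eqP; rewrite eqn_leq dim_le -cardR leq_subLR addnC.
(* All labels agree, so one colour suffices and at most one ray is free of [R]. *)
apply: (resolving_card_ge starP (c := fun=> ord0) _ resR) => i j _.
by apply: funext => t; apply: propext; rewrite !star_labelingE.
Qed.

(** * Assembly of the bounds and their tightness *)

Theorem theorem16 (l p : nat) (hl : 2 <= l) (hp : 1 <= p) :
  [/\ (forall (S : sgraph) (lam : labeling S),
         subdivided_star S -> #|leaves S| = l -> periodic_1labeling p lam ->
         maxn 1 (l - p) <= temporal_metric_dim lam <= l - 1),
      (exists (S : sgraph) (lam : labeling S),
         [/\ subdivided_star S, #|leaves S| = l, periodic_1labeling p lam
           & temporal_metric_dim lam = maxn 1 (l - p)])
    & (exists (S : sgraph) (lam : labeling S),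
         [/\ subdivided_star S, #|leaves S| = l, periodic_1labeling p lam
           & temporal_metric_dim lam = l - 1])].
Proof.
split.
- move=> S lam [m [k [f [g fK gK] f_adj]]] card_l lamP.
  (* The labeling lives on [S], so it is pulled back to the model [substar k] along the inverse
     isomorphism [g]. *)
  have g_bij : bijective g by exists f.
  have g_adj x y : adj (g x) (g y) = adj x y by rewrite -f_adj !gK.
  rewrite -(pull_metric_dim g_bij g_adj lamP) -card_l -(card_leaves_bij g_bij g_adj).
  apply: substar_metric_dim_bounds => //; first exact: pull_periodic.
  by rewrite (card_leaves_bij g_bij g_adj) card_l.
- exists (star l), (star_labeling p (fun i : 'I_l => i %% p)); split.
  + exact: star_subdivided.
  + exact: card_leaves_star.
  + by apply: star_periodic => i; rewrite ltn_mod.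
  + exact: star_metric_dim_distinct.
- exists (star l), (star_labeling p (fun _ : 'I_l => 0)); split.
  + exact: star_subdivided.
  + exact: card_leaves_star.
  + exact: star_periodic.
  + exact: star_metric_dim_constant.
Qed.
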